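(* Let $n\ge 2$ be an integer and let $A\subseteq\mathbb{F}_{2^{n-1}}\setminus\{0\}$ with $|A|=k\ge 3$. Then there exists a subset of $\mathbb{F}_{2^n}\setminus\{0\}$ of size $2k$ whose $r$-value is $4r(A)$.
   Context: For a subset $X$ of a finite additive abelian group, the $r$-value $r(X)$ is the number of ordered pairs $(x,y)\in X\times X$ with $x+y\in X$. Only the additive group of $\mathbb{F}_{2^n}$ is used: its elements are written as vectors $[\alpha_1,\dots,\alpha_n]$ with $\alpha_i\in\{0,1\}$ and addition coordinatewise modulo 2. By convention $\mathbb{F}_{2^{n-1}}$ is regarded as the subset of $\mathbb{F}_{2^n}$ consisting of the vectors with first coordinate $\alpha_1=0$. *)

(* Defs.v *)
From HB Require Import structures.
From mathcomp Require Import all_boot all_order all_algebra.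

Set Implicit Arguments.
Unset Strict Implicit.
Unset Printing Implicit Defensive.

Import GRing.Theory.
Local Open Scope ring_scope.

Definition r_value (G : finZmodType) (X : {set G}) : nat :=
  #|[set p in setX X X | p.1 + p.2 \in X]|.

(* Only the additive group of the field with 2 ^ n elements is used, so it is
   represented by row vectors with entries in 'F_2. *)
Notation F2n n := 'rV['F_2]_n.

(* The copy of F2n n.-1 inside F2n n: vectors whose first coordinate is zero.
   Quantifying over indices of value 0 avoids a cast to a successor
   dimension; for 0 < n there is exactly one such index. *)
Definition first_coord0 (n : nat) : {set F2n n} :=
  [set v : F2n n | [forall i : 'I_n, (nat_of_ord i == 0%N) ==> (v 0 i == 0)]].

(* Main.v *)
From HB Require Import structures.
Require Import Defs.
From mathcomp Require Import all_boot all_order all_algebra.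

Import GRing.Theory.

Local Open Scope ring_scope.

(** Take for [B] the preimage of [A] under the projection that erases the first
    coordinate, that is, [A] together with its translate by the first basis
    vector. Since the projection is additive, a pair of elements of [B] has its
    sum in [B] exactly when the pair of projections has its sum in [A].
    Each element of [A] has exactly two preimages, so each element
    of [A] contributes 2 elements to [B], and each pair counted by [r(A)]
    contributes 2 * 2 pairs to [r(B)] ([r_value_preim]). Finally [0] projects
    to [0], which is not in [A]. *)

Lemma card_preimset_fibers {S T : finType} (f : S -> T) (Y : {set T}) (m : nat) :
    (forall y, y \in Y -> #|f @^-1: [set y]| = m) ->
  #|f @^-1: Y| = (m * #|Y|)%N.
Proof.
move=> fibm; rewrite -sum1_card (partition_big f (mem Y)) /=; last first.
  by move=> x; rewrite inE.
rewrite mulnC -sum_nat_const; apply: eq_bigr => y Yy.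
rewrite -(fibm y Yy) -sum1_card; apply: eq_bigl => x.
by rewrite !inE; case: eqP => [->|]; rewrite ?Yy ?andbF.
Qed.

(** The pairs counted by the r-value of a preimage are themselves the preimage,
    under the map acting on both entries, of the pairs counted downstairs; a
    fiber of that map is a product of two fibers. *)
Lemma r_value_preim {G H : finZmodType} (f : {additive G -> H}) (X : {set H})
    (m : nat) :
    (forall x, x \in X -> #|f @^-1: [set x]| = m) ->
  r_value (f @^-1: X) = (m ^ 2 * r_value X)%N.
Proof.
move=> fibm; rewrite /r_value.
pose f2 (p : G * G) := (f p.1, f p.2).
rewrite -(card_preimset_fibers f2) => [|[x y]].
  by apply: eq_card => -[u v]; rewrite !inE /= raddfD.
rewrite !inE /= => /andP[/andP[Xx Xy] _].
rewrite expnS expn1 -{1}(fibm x Xx) -(fibm y Xy) -cardsX.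
by apply: eq_card => -[u v]; rewrite !inE.
Qed.

Definition erase_coord {R : pzRingType} {n : nat} (i : 'I_n) (v : 'rV[R]_n) :
    'rV[R]_n := \row_j (if j == i then 0 else v 0 j).

Lemma erase_coord_is_additive {R : pzRingType} {n : nat} (i : 'I_n) :
  zmod_morphism (@erase_coord R n i).
Proof.
by move=> u v; apply/rowP => j; rewrite !mxE; case: eqP; rewrite ?subr0.
Qed.

HB.instance Definition _ (R : pzRingType) (n : nat) (i : 'I_n) :=
  GRing.isZmodMorphism.Build _ _ (@erase_coord R n i)
    (@erase_coord_is_additive R n i).

(** The fiber over [v] is the line through [v] in direction [i],
    parametrized by the erased coordinate. *)
Lemma card_erase_coord_fiber {R : finNzRingType} {n : nat} (i : 'I_n)
    (v : 'rV[R]_n) :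
  v 0 i = 0 -> #|erase_coord i @^-1: [set v]| = #|R|.
Proof.
move=> vi0; pose line c : 'rV[R]_n := \row_j (if j == i then c else v 0 j).
have line_inj : injective line.
  by move=> c d /rowP/(_ i); rewrite !mxE eqxx.
rewrite -(card_codom line_inj); apply: eq_card => w; rewrite !inE.
apply/eqP/codomP => [fw|[c ->]].
  by exists (w 0 i); apply/rowP => j; rewrite !mxE -fw mxE; case: eqP => [->|].
by apply/rowP => j; rewrite !mxE; case: eqP => [->|].
Qed.

Theorem proposition4p14 (n : nat) (hn : (2 <= n)%N) (k : nat)
    (A : {set F2n n}) (hA : A \subset first_coord0 n :\ 0)
    (hcard : #|A| = k) (hk : (3 <= k)%N) :
  exists B : {set F2n n},
    [/\ B \subset [set: F2n n] :\ 0,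
        #|B| = (2 * k)%N &
        r_value B = (4 * r_value A)%N].
Proof.
pose i0 : 'I_n := Ordinal (ltnW hn).
have fib2 v : v \in A -> #|erase_coord i0 @^-1: [set v]| = 2.
  move=> /(subsetP hA); rewrite !inE => /andP[_ /forallP/(_ i0)/eqP vi0].
  by rewrite card_erase_coord_fiber ?card_Fp.
exists (erase_coord i0 @^-1: A); split.
- apply/subsetP => v; rewrite !inE andbT; apply: contraTneq => ->.
  by rewrite raddf0; apply/negP => /(subsetP hA); rewrite !inE eqxx.
- by rewrite (card_preimset_fibers _ _ 2 fib2) hcard.
- by rewrite (r_value_preim _ _ 2 fib2).
Qed.
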